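(* Let $B\in\mathbb{C}^{m\times n}$, $\tilde W\in\mathbb{C}^{n\times m}$, $\tilde k=\max\{\mathrm{ind}(B\tilde W),\mathrm{ind}(\tilde W B)\}$ and $\mathrm{rank}((B\tilde W)^{\tilde k})=q$, and let $$B=M\begin{bmatrix}B_1&B_2\\0&B_3\end{bmatrix}N^*,\qquad \tilde W=N\begin{bmatrix}\tilde W_1&\tilde W_2\\0&\tilde W_3\end{bmatrix}M^*,$$ where $M\in\mathbb{C}^{m\times m}$, $N\in\mathbb{C}^{n\times n}$ are unitary, $B_1,\tilde W_1\in\mathbb{C}^{q\times q}$ are nonsingular, $B_2\in\mathbb{C}^{q\times(n-q)}$, $\tilde W_2\in\mathbb{C}^{q\times(m-q)}$, $B_3\in\mathbb{C}^{(m-q)\times(n-q)}$, $\tilde W_3\in\mathbb{C}^{(n-q)\times(m-q)}$, and $B_3\tilde W_3$ and $\tilde W_3B_3$ are nilpotent of indices $\mathrm{ind}(B\tilde W)$ and $\mathrm{ind}(\tilde W B)$, respectively. Let $X$ be a minimal rank $W$-weighted weak Drazin inverse of $B$, decomposed as $$X=M\begin{bmatrix}(\tilde W_1B_1\tilde W_1)^{-1}&X_2\\0&0\end{bmatrix}N^*,$$ where $X_2\in\mathbb{C}^{q\times(n-q)}$ is arbitrary. Then $$B^{\dagger}B\tilde W X\tilde W=N\begin{bmatrix}B_1^*\Delta Q& B_1^*D+B_1^*\Delta B_1\tilde W_1X_2\tilde W_3\\ (I-B_3^{\dagger}B_3)B_2^*\Delta Q&(I-B_3^{\dagger}B_3)B_2^*D+(I-B_3^{\dagger}B_3)B_2^*\Delta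 B_1\tilde W_1X_2\tilde W_3\end{bmatrix}M^*,$$ where $Q=B_1\tilde W_1(\tilde W_1B_1\tilde W_1)^{-1}\tilde W_1$, $\Delta=\bigl(B_1B_1^*+B_2(I-B_3^{\dagger}B_3)B_2^*\bigr)^{-1}$ and $D=\Delta B_1\tilde W_1(\tilde W_1B_1\tilde W_1)^{-1}\tilde W_2$.
   Context: $^*$ denotes conjugate transpose and $^{\dagger}$ the Moore-Penrose inverse. For a square complex matrix $T$, $\mathrm{ind}(T)$ is the smallest nonnegative integer $k$ with $\mathrm{rank}(T^k)=\mathrm{rank}(T^{k+1})$ (with $T^0=I$). A matrix $X\in\mathbb{C}^{m\times n}$ is a minimal rank $W$-weighted weak Drazin inverse of $B$ (with respect to the weight $\tilde W$) if, with $k=\mathrm{ind}(B\tilde W)$, $X\tilde W(B\tilde W)^{k+1}=(B\tilde W)^{k}$ and $\mathrm{rank}(X)=\mathrm{rank}((B\tilde W)^{k})$. *)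

(* Defs.v *)
From HB Require Import structures.
From mathcomp Require Import all_boot all_order all_algebra.
From mathcomp Require Import reals.
From mathcomp.real_closed Require Import complex.

Set Implicit Arguments.
Unset Strict Implicit.
Unset Printing Implicit Defensive.

Import Order.TTheory GRing.Theory Num.Theory.

Local Open Scope ring_scope.
Local Open Scope sesquilinear_scope.

Section Index.
Variables (F : fieldType) (n : nat).
Implicit Type T : 'M[F]_n.

Lemma mxind_exists T : exists k, \rank (T ^+ k) == \rank (T ^+ k.+1).
Proof.
suff H r : forall k, (\rank (T ^+ k) <= r)%N ->
    exists j, \rank (T ^+ j) == \rank (T ^+ j.+1).
  exact: (H _ 0%N (leqnn _)).
elim: r => [|r IHr] k le_k_r.
all: have le_rk : (\rank (T ^+ k.+1) <= \rank (T ^+ k))%N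
  by rewrite exprS; exact: mxrankM_maxr.
  by exists k; rewrite eqn_leq le_rk andbT (leq_trans le_k_r).
have [eq_rk|ne_rk] := eqVneq (\rank (T ^+ k)) (\rank (T ^+ k.+1)).
  by exists k; apply/eqP.
by apply: (IHr k.+1); rewrite -ltnS (leq_trans _ le_k_r) // ltn_neqAle eq_sym ne_rk.
Qed.

Definition mxind T : nat := ex_minn (mxind_exists T).

Definition nilpotent_of_index T (k : nat) : Prop :=
  T ^+ k = 0 /\ forall j : nat, (j < k)%N -> T ^+ j != 0.

End Index.

Section MoorePenrose.
Variable C : numClosedFieldType.

Definition is_moore_penrose m n (A : 'M[C]_(m, n)) : pred 'M[C]_(n, m) :=
  fun Y => [&& A *m Y *m A == A, Y *m A *m Y == Y,
               (A *m Y)^t* == A *m Y & (Y *m A)^t* == Y *m A].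

Lemma mulmx_tC_eq0 m n (A : 'M[C]_(m, n)) : A *m A^t* = 0 -> A = 0.
Proof.
move=> AA0; apply/matrixP => i j; rewrite mxE; apply/eqP.
have /eqP : (A *m A^t*) i i = 0 by rewrite AA0 mxE.
rewrite mxE psumr_eq0 => [/allP/(_ j (mem_index_enum j))|k _].
  by rewrite !mxE -normCK expf_eq0 normr_eq0.
by rewrite !mxE -normCK exprn_ge0.
Qed.

Lemma mulmx_tC m n p (A : 'M[C]_(m, n)) (B : 'M[C]_(n, p)) :
  (A *m B)^t* = B^t* *m A^t*.
Proof. by rewrite trmx_mul map_mxM. Qed.

Lemma row_free_gram m n (A : 'M[C]_(m, n)) :
  row_free A -> A *m A^t* \in unitmx.
Proof.
move=> Afree; rewrite -row_free_unit -kermx_eq0; apply/eqP.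
set K := kermx _.
have K0 : K *m A *m A^t* = 0 by rewrite -mulmxA mulmx_ker.
apply/eqP; rewrite -(mulmx_free_eq0 _ Afree); apply/eqP/mulmx_tC_eq0.
by rewrite mulmx_tC mulmxA K0 mul0mx.
Qed.

Lemma moore_penrose_full_rank m s n (P : 'M[C]_(m, s)) (S : 'M[C]_(s, n)) :
    S *m S^t* \in unitmx -> P^t* *m P \in unitmx ->
  is_moore_penrose (P *m S)
    (S^t* *m invmx (S *m S^t*) *m (invmx (P^t* *m P) *m P^t*)).
Proof.
move=> SU PU; set Y := _ *m (_ *m P^t*).
have hermV p (G : 'M[C]_p) : G^t* = G -> (invmx G)^t* = invmx G.
  by move=> hG; rewrite trmx_inv map_invmx hG.
have SH : (S *m S^t*)^t* = S *m S^t* by rewrite mulmx_tC trmxCK.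
have PH : (P^t* *m P)^t* = P^t* *m P by rewrite mulmx_tC trmxCK.
have AY : P *m S *m Y = P *m invmx (P^t* *m P) *m P^t*.
  rewrite /Y -(mulmxA P S) !(mulmxA S) mulmxV // mul1mx.
  by rewrite (mulmxA P).
have YA : Y *m (P *m S) = S^t* *m invmx (S *m S^t*) *m S.
  rewrite /Y -(mulmxA _ _ (P *m S)); congr (_ *m _).
  by rewrite (mulmxA _ P S) -(mulmxA (invmx _)) mulVmx ?mul1mx.
apply/and4P; split; apply/eqP.
- by rewrite AY (mulmxA _ P S) -(mulmxA _ (P^t*) P) mulmxKV.
- by rewrite YA /Y (mulmxA _ (S^t* *m _)) (mulmxA _ (S^t*)) -(mulmxA _ S (S^t*)) mulmxKV.
- by rewrite AY !mulmx_tC trmxCK hermV // mulmxA.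
- by rewrite YA !mulmx_tC trmxCK hermV // mulmxA.
Qed.

Lemma moore_penrose_exists m n (A : 'M[C]_(m, n)) :
  exists Y, is_moore_penrose A Y.
Proof.
have SU : row_base A *m (row_base A)^t* \in unitmx.
  by apply: row_free_gram; exact: row_base_free.
have PU : (col_base A)^t* *m col_base A \in unitmx.
  have := @row_free_gram _ _ ((col_base A)^t*); rewrite trmxCK; apply.
  rewrite /row_free mxrank_map mxrank_tr.
  by have := col_base_full A; rewrite /row_full.
have := moore_penrose_full_rank SU PU; rewrite mulmx_base => AY.
by eexists; exact: AY.
Qed.

Lemma moore_penrose_unique m n (A : 'M[C]_(m, n)) Y Z :
  is_moore_penrose A Y -> is_moore_penrose A Z -> Y = Z.
Proof.
case/and4P => /eqP a1 /eqP a2 /eqP a3 /eqP a4.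
case/and4P => /eqP b1 /eqP b2 /eqP b3 /eqP b4.
have AYZ : A *m Y = A *m Z.
  by rewrite -a3 -{1}b1 -[A *m Z *m A *m Y]mulmxA mulmx_tC a3 b3 mulmxA a1.
have YZA : Y *m A = Z *m A.
  by rewrite -a4 -{1}b1 -(mulmxA A Z A) mulmxA mulmx_tC a4 b4 -mulmxA (mulmxA A Y) a1.
by rewrite -a2 YZA -mulmxA AYZ mulmxA b2.
Qed.

Definition mpinv m n (A : 'M[C]_(m, n)) : 'M[C]_(n, m) :=
  xchoose (moore_penrose_exists A).

Lemma mpinvP m n (A : 'M[C]_(m, n)) : is_moore_penrose A (mpinv A).
Proof. exact: (xchooseP (moore_penrose_exists A)). Qed.

Definition min_rank_weak_drazin m n (B : 'M[C]_(m, n)) (W : 'M[C]_(n, m))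
    (X : 'M[C]_(m, n)) : Prop :=
  let k := mxind (B *m W) in
  X *m W *m (B *m W) ^+ k.+1 = (B *m W) ^+ k /\
  \rank X = \rank ((B *m W) ^+ k).

End MoorePenrose.

(* Main.v *)
(** The matrix [mpinv B *m B] is the Hermitian idempotent fixing [B^t*], so
    [mpinv B *m B *m Y = Z] as soon as [Z] lies in the column space of [B^t*]
    and [B *m Z = B *m Y].  Since [X] has only one nonzero block row, [W *m X *m W]
    factors through the first block column [Y] of [N]; for it
    [Z = N *m col_mx (B1^t* ) (P *m B2^t* ) *m Delta *m B1]. *)

Require Import Defs.
From HB Require Import structures.
From mathcomp Require Import all_boot all_order all_algebra.
From mathcomp Require Import reals.
From mathcomp.real_closed Require Import complex.

Set Implicit Arguments.
Unset Strict Implicit.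
Unset Printing Implicit Defensive.

Import Order.TTheory GRing.Theory Num.Theory.

Local Open Scope ring_scope.
Local Open Scope sesquilinear_scope.

Section Projector.
Variable C : numClosedFieldType.

(** Since [mpinv A *m A] is Hermitian, the left side is the conjugate transpose of
    [A *m mpinv A *m A], that is, of [A]. *)
Lemma mpinv_mulmx_tC m n (A : 'M[C]_(m, n)) : mpinv A *m A *m A^t* = A^t*.
Proof.
case/and4P: (mpinvP A) => /eqP AYA _ _ /eqP YAH.
by rewrite -{1}YAH -mulmx_tC mulmxA AYA.
Qed.

Lemma mpinv_mulmx_eq m n l (A : 'M[C]_(m, n)) (V : 'M[C]_(m, l))
    (Y : 'M[C]_(n, l)) :
  A *m (A^t* *m V) = A *m Y -> mpinv A *m A *m Y = A^t* *m V.
Proof. by move=> eqAY; rewrite -mulmxA -eqAY !mulmxA mpinv_mulmx_tC. Qed.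

Lemma mulmx_compl_mpinv m n (A : 'M[C]_(m, n)) :
  A *m (1%:M - mpinv A *m A) = 0.
Proof.
case/and4P: (mpinvP A) => /eqP AYA _ _ _.
by rewrite mulmxBr mulmx1 mulmxA AYA subrr.
Qed.

Lemma compl_mpinv_tC m n (A : 'M[C]_(m, n)) :
  (1%:M - mpinv A *m A)^t* = 1%:M - mpinv A *m A.
Proof.
case/and4P: (mpinvP A) => _ _ _ /eqP YAH.
by rewrite linearB /= map_mxB YAH trmx1 map_mx1.
Qed.

Lemma compl_mpinv_idem m n (A : 'M[C]_(m, n)) :
  (1%:M - mpinv A *m A) *m (1%:M - mpinv A *m A) = 1%:M - mpinv A *m A.
Proof. by rewrite {1}mulmxBl mul1mx -mulmxA mulmx_compl_mpinv mulmx0 subr0. Qed.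

Lemma tC_unitarymxK m n (U : 'M[C]_m) :
  U \is unitarymx -> cancel (@mulmx _ m m n U) (mulmx (U^t*)).
Proof. by move=> /unitarymxP/mulmx1C UU A; rewrite mulmxA UU mul1mx. Qed.

Lemma tC_block_mx m1 m2 n1 n2 (A : 'M[C]_(m1, n1)) (B : 'M[C]_(m1, n2))
    (D : 'M[C]_(m2, n1)) (E : 'M[C]_(m2, n2)) :
  (block_mx A B D E)^t* = block_mx (A^t*) (D^t*) (B^t*) (E^t*).
Proof. by rewrite tr_block_mx map_block_mx. Qed.

(* The matrix is the Gram matrix of the rows of [row_mx A (B *m P)]. *)
Lemma gram_compl_unitmx q p r (A : 'M[C]_q) (B : 'M[C]_(q, r))
    (E : 'M[C]_(p, r)) : A \in unitmx ->
  A *m A^t* + B *m (1%:M - mpinv E *m E) *m B^t* \in unitmx.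
Proof.
move=> Au; set P := 1%:M - _.
have Lfree : row_free (row_mx A (B *m P)).
  apply/row_freeP; exists (col_mx (invmx A) 0).
  by rewrite mul_row_col mulmxV // mulmx0 addr0.
have := row_free_gram Lfree.
(* As [P] is a Hermitian idempotent, the block [B *m P] contributes [B *m P *m B^t*]. *)
rewrite tr_row_mx map_col_mx mul_row_col mulmx_tC compl_mpinv_tC.
by rewrite mulmxA -(mulmxA B P P) compl_mpinv_idem.
Qed.

Lemma mpinv_block_upper q p r (M : 'M[C]_(q + p)) (N : 'M[C]_(q + r))
    (B1 : 'M[C]_q) (B2 : 'M[C]_(q, r)) (B3 : 'M[C]_(p, r)) :
  M \is unitarymx -> N \is unitarymx -> B1 \in unitmx ->
  let B := M *m block_mx B1 B2 0 B3 *m N^t* in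
  let P := 1%:M - mpinv B3 *m B3 in
  let Delta := invmx (B1 *m B1^t* + B2 *m P *m B2^t*) in
  mpinv B *m B *m (N *m col_mx 1%:M 0) =
    N *m col_mx (B1^t* *m Delta *m B1) (P *m B2^t* *m Delta *m B1).
Proof.
move=> hM hN hB1 B P Delta.
have PE : B2^t* - B3^t* *m (B2 *m mpinv B3)^t* = P *m B2^t*.
  rewrite -mulmx_tC -mulmxA -[P]compl_mpinv_tC -mulmx_tC mulmxBr mulmx1.
  by rewrite linearB /= map_mxB.
(* The lower block is chosen so that, by [PE], applying [B^t*] turns [B2^t*] into [P *m B2^t*]; this
   puts the candidate in the column space of [B^t*]. *)
pose V := M *m (col_mx 1%:M (- (B2 *m mpinv B3)^t*) *m (Delta *m B1)).
have BV : B^t* *m V =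
    N *m col_mx (B1^t* *m Delta *m B1) (P *m B2^t* *m Delta *m B1).
  rewrite /B !mulmx_tC trmxCK -!mulmxA /V (tC_unitarymxK hM); congr (_ *m _).
  rewrite mulmxA tC_block_mx mul_block_col trmx0 map_mx0 mul0mx addr0 !mulmx1.
  by rewrite mulmxN PE mul_col_mx !mulmxA.
rewrite -BV; apply: mpinv_mulmx_eq; rewrite BV /B -!mulmxA !(tC_unitarymxK hN).
congr (_ *m _); rewrite !mul_block_col !mulmx1 !mul0mx !mulmx0 !add0r addr0.
(* The lower block vanishes by [B3 *m P = 0]; in the upper one the Gram matrix cancels [Delta] and
   leaves [B1]. *)
rewrite !mulmxA mulmx_compl_mpinv !mul0mx -!mulmxDl mulmxV ?mul1mx //.
exact: gram_compl_unitmx.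
Qed.

End Projector.

(* The block decompositions split m = q + p and n = q + r, that is,
   p = m - q and r = n - q. *)
Theorem theorem3p16 (R : realType) (q p r : nat)
  (B : 'M[R[i]]_(q + p, q + r)) (W : 'M[R[i]]_(q + r, q + p))
  (hq : \rank ((B *m W) ^+ maxn (mxind (B *m W)) (mxind (W *m B))) = q)
  (M : 'M[R[i]]_(q + p)) (N : 'M[R[i]]_(q + r))
  (B1 W1 : 'M[R[i]]_q)
  (B2 : 'M[R[i]]_(q, r)) (W2 : 'M[R[i]]_(q, p))
  (B3 : 'M[R[i]]_(p, r)) (W3 : 'M[R[i]]_(r, p))
  (hM : M \is unitarymx) (hN : N \is unitarymx)
  (hB1 : B1 \in unitmx) (hW1 : W1 \in unitmx)
  (hBW3 : nilpotent_of_index (B3 *m W3) (mxind (B *m W)))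
  (hWB3 : nilpotent_of_index (W3 *m B3) (mxind (W *m B)))
  (hB : B = M *m block_mx B1 B2 0 B3 *m N^t*)
  (hW : W = N *m block_mx W1 W2 0 W3 *m M^t*)
  (X : 'M[R[i]]_(q + p, q + r)) (X2 : 'M[R[i]]_(q, r))
  (hX : min_rank_weak_drazin B W X)
  (hX2 : X = M *m block_mx (invmx (W1 *m B1 *m W1)) X2 0 0 *m N^t*) :
  let Q := B1 *m W1 *m invmx (W1 *m B1 *m W1) *m W1 in
  let P := 1%:M - mpinv B3 *m B3 in
  let Delta := invmx (B1 *m B1^t* + B2 *m P *m B2^t*) in
  let D := Delta *m B1 *m W1 *m invmx (W1 *m B1 *m W1) *m W2 in
  mpinv B *m B *m W *m X *m W =
    N *m block_mx
      (B1^t* *m Delta *m Q)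
      (B1^t* *m D + B1^t* *m Delta *m B1 *m W1 *m X2 *m W3)
      (P *m B2^t* *m Delta *m Q)
      (P *m B2^t* *m D + P *m B2^t* *m Delta *m B1 *m W1 *m X2 *m W3)
    *m M^t*.
Proof.
move=> Q P Delta D.
set E := invmx (W1 *m B1 *m W1) in hX2 Q D *.
(* The lower block row of [M^t* *m X] is zero, so the left [W] acts only through [W1], which splits
   off the block column handled by [mpinv_block_upper]. *)
have WXW : W *m X *m W =
    N *m col_mx 1%:M 0 *m (W1 *m row_mx (E *m W1) (E *m W2 + X2 *m W3) *m M^t*).
  rewrite hW hX2 -!mulmxA (tC_unitarymxK hN) (tC_unitarymxK hM).
  congr (_ *m _); rewrite !mulmxA; congr (_ *m _).
  rewrite -[RHS]mulmxA !mulmx_block mul_col_mx mul1mx mul0mx mul_mx_row.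
  rewrite /block_mx !(mul0mx, mulmx0, addr0) row_mx0 mulmxDr.
  by rewrite !mulmxA.
rewrite -!mulmxA (mulmxA W) WXW (mulmxA (mpinv B)) (mulmxA (mpinv B *m B)).
rewrite {1 2}hB mpinv_block_upper // -/P -/Delta -!mulmxA; congr (_ *m _).
rewrite !mulmxA; congr (_ *m _); rewrite -mulmxA mul_mx_row mul_col_row.
(* Here [B1 *m W1 *m E *m W1] is [Q] and [Delta *m B1 *m W1 *m E *m W2] is [D]. *)
by rewrite /Q /D !mulmxDr !mulmxA.
Qed.
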